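(* Let $\mathbf{C}$ be either the class of cancellative cones or the class of separative cones. Then every element of $\mathbf{C}$ admits a unitary embedding into a normally divisible refinement cone, and every element of $\mathbf{C}$ admits a strong unitary embedding into a refinement cone.
   Context: Commutative monoids are written additively. The algebraic preordering of a commutative monoid $M$ is $x\le y\iff(\exists z\in M)(x+z=y)$. A cone is a commutative monoid that is conical: $x+y=0\Rightarrow x=y=0$. It is cancellative if $x+z=y+z\Rightarrow x=y$, and separative if $2x=x+y=2y\Rightarrow x=y$. A refinement cone is a cone with the refinement property: whenever $a_0+a_1=b_0+b_1$ there are $c_{ij}$ ($i,j<2$) with $a_i=c_{i0}+c_{i1}$ and $b_i=c_{0i}+c_{1i}$ for all $i<2$. A commutative monoid $M$ is normally divisible if for every positive integer $p$, every finite subset $X\subseteq M$ and every $a\in M$, there is $u\in M$ with $pu=a$ and, for all $x,y\in X$, $x+a=y+a\Rightarrow x+u=y+u$. A homomorphism $f:A\to B$ of commutative monoids is unitary (a unitary embedding) if it is one-to-one, has cofinal image (every $b\in B$ satisfies $b\le f(a)$ for some $a\in A$), and for all $a_0,a_1\in A$, $b\in B$, $f(a_0)+b=f(a_1)$ implies $b\in f[A]$. It is strongly unitary (a strong unitary embedding) if it is unitary and for all positive integers $m$ and all $b\in B$, $mb\in f[A]$ implies $b\in f[A]$. *)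

(* Defs.v *)
From mathcomp Require Import all_boot all_algebra.

Set Implicit Arguments.
Unset Strict Implicit.
Unset Printing Implicit Defensive.

Local Open Scope ring_scope.

Definition alg_le (M : nmodType) (x y : M) : Prop := exists z : M, x + z = y.

Definition cone (M : nmodType) : Prop :=
  forall x y : M, x + y = 0 -> x = 0 /\ y = 0.

Definition cancellative (M : nmodType) : Prop :=
  forall x y z : M, x + z = y + z -> x = y.

Definition separative (M : nmodType) : Prop :=
  forall x y : M, x *+ 2 = x + y -> x + y = y *+ 2 -> x = y.

Definition refinement (M : nmodType) : Prop :=
  forall a0 a1 b0 b1 : M, a0 + a1 = b0 + b1 ->
  exists c00 c01 c10 c11 : M,
    [/\ a0 = c00 + c01, a1 = c10 + c11, b0 = c00 + c10 & b1 = c01 + c11].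

(* The finite subset X of M is given by a list of its elements. *)
Definition normally_divisible (M : nmodType) : Prop :=
  forall (p : nat) (X : seq M) (a : M), (0 < p)%N ->
  exists u : M, u *+ p = a /\
    (forall x y : M, x \in X -> y \in X -> x + a = y + a -> x + u = y + u).

Definition cancellative_cone (M : nmodType) : Prop := cone M /\ cancellative M.

Definition separative_cone (M : nmodType) : Prop := cone M /\ separative M.

Definition refinement_cone (M : nmodType) : Prop := cone M /\ refinement M.

Definition in_image (A B : Type) (f : A -> B) (b : B) : Prop :=
  exists a : A, f a = b.

Definition unitary (A B : nmodType) (f : {additive A -> B}) : Prop :=
  [/\ injective f,
      forall b : B, exists a : A, alg_le b (f a)
    & forall (a0 a1 : A) (b : B), f a0 + b = f a1 -> in_image f b].

Definition strongly_unitary (A B : nmodType) (f : {additive A -> B}) : Prop :=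
  unitary f /\
  forall (m : nat) (b : B), (0 < m)%N -> in_image f (b *+ m) -> in_image f b.

(* Main.v *)
(* Adjoin to a cone M formal solutions c_ij of all the equations
   a0 + a1 = b0 + b1 between nonzero elements.  Give c00 and c11 degree 1 and
   c01 and c10 degree -1.  A word of degree zero (for each equation) has a
   well-defined value in M: cancel the c_ij in pairs of opposite degrees, using
   c00 + c01 = a0, c00 + c10 = b0, etc.; the result does not depend on the
   pairing because a0 + a1 = b0 + b1.  Dividing the words by the coarsest
   congruence compatible with degrees and values yields a cone whose elements of
   degree zero are exactly those of M, so that M embeds in it unitarily, and even
   strongly unitarily as degrees are torsion-free.  To adjoin u with p u = a, use
   degrees modulo p instead: u then absorbs whatever a absorbs, because every word
   of degree zero that involves u has a value above a.  Iterate omega times and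
   take the direct limit. *)
From HB Require Import structures.
Require Import Defs.
From mathcomp Require Import all_boot all_algebra.
From mathcomp Require Import boolp zify.

Set Implicit Arguments.
Unset Strict Implicit.
Unset Printing Implicit Defensive.

Import GRing.Theory.
Local Open Scope ring_scope.
Local Open Scope quotient_scope.

(** * Preliminaries on conical sums, supports and the algebraic preordering *)

Section Cones.

Variables (M : nmodType) (coneM : cone M).

Lemma cone_sum_eq0 (I : eqType) (s : seq I) (F : I -> M) :
  \sum_(i <- s) F i = 0 -> forall i, i \in s -> F i = 0.
Proof.
elim: s => [|j s IHs] //; rewrite big_cons => /coneM[Fj Fs] i.
by rewrite inE => /predU1P[->//|]; exact: IHs.
Qed.

Lemma cone_mulrn_eq0 (a : M) n : a != 0 -> a *+ n = 0 -> n = 0%N.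
Proof. by case: n => // n a0; rewrite mulrS => /coneM[/eqP]; rewrite (negPf a0). Qed.

End Cones.

Lemma eq_big_support (M : nmodType) (I : eqType) (s t : seq I) (F : I -> M) :
  uniq s -> uniq t -> (forall i, i \notin s -> F i = 0) ->
  (forall i, i \notin t -> F i = 0) -> \sum_(i <- s) F i = \sum_(i <- t) F i.
Proof.
move=> us ut Fs Ft.
have E (r1 r2 : seq I) : (forall i, i \notin r2 -> F i = 0) ->
    \sum_(i <- r1) F i = \sum_(i <- [seq i <- r1 | i \in r2]) F i.
  move=> Fr; rewrite big_filter [RHS]big_mkcond; apply: eq_bigr => i _.
  by case: ifPn => // /Fr.
rewrite (E s t) // (E t s) //; apply: perm_big; apply: uniq_perm.
- exact: filter_uniq.
- exact: filter_uniq.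
- by move=> i; rewrite !mem_filter andbC.
Qed.

Lemma alg_leD (M : nmodType) (x y x' y' : M) :
  alg_le x y -> alg_le x' y' -> alg_le (x + x') (y + y').
Proof. by move=> [z <-] [z' <-]; exists (z + z'); rewrite addrACA. Qed.

Lemma alg_le_trans (M : nmodType) (x y z : M) :
  alg_le x y -> alg_le y z -> alg_le x z.
Proof. by move=> [u <-] [v <-]; exists (u + v); rewrite addrA. Qed.

(* [neutral e v] says that the combination [v] of the generators adjoined for
   the equation [e] has degree zero; [val_of e v] is junk otherwise. *)
Record gradation (M : nmodType) := Gradation {
  idx : choiceType;
  wgt : nmodType;
  neutral : idx -> wgt -> Prop;
  val_of : idx -> wgt -> M;
  neutral0 : forall e, neutral e 0;
  neutralD : forall e v w, neutral e v -> neutral e w -> neutral e (v + w);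
  neutralB : forall e v w, neutral e v -> neutral e (v + w) -> neutral e w;
  neutral_cofinal : forall e v, exists w, neutral e (v + w);
  val_of0 : forall e, val_of e 0 = 0;
  val_ofD : forall e v w, neutral e v -> neutral e w ->
    val_of e (v + w) = val_of e v + val_of e w }.

(** * Extensions with a prescribed part of degree zero *)

Section Extension.

Variables (M : nmodType) (D : gradation M).

Local Notation word := (M * seq (idx D * wgt D))%type.

Implicit Types w z : word.

Definition coef w (e : idx D) : wgt D := \sum_(p <- w.2 | p.1 == e) p.2.
Definition catw w z : word := (w.1 + z.1, w.2 ++ z.2).
Definition neutralw w : Prop := forall e, neutral e (coef w e).
Definition supp w := undup [seq p.1 | p <- w.2].
Definition valw w : M := w.1 + \sum_(e <- supp w) val_of e (coef w e).

Lemma coef_cat w z e : coef (catw w z) e = coef w e + coef z e.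
Proof. by rewrite /coef big_cat. Qed.

Lemma coef_out w e : e \notin supp w -> coef w e = 0.
Proof.
rewrite mem_undup => ew; rewrite /coef big1_seq // => p /andP[/eqP pe pw].
by case/negP: ew; rewrite -pe map_f.
Qed.

(** Off its support a word has coefficient 0, which contributes nothing by [val_of0]. Hence the
    values of several words can be compared as sums over one common list of indices. *)
Lemma valwE (s : seq (idx D)) w : uniq s -> {subset supp w <= s} ->
  valw w = w.1 + \sum_(e <- s) val_of e (coef w e).
Proof.
move=> us ws; congr (_ + _); apply: eq_big_support => // [|e|e es].
- exact: undup_uniq.
- by move=> /coef_out->; rewrite val_of0.
- by rewrite coef_out ?val_of0 //; apply: contra es; exact: ws.
Qed.

Definition common_supp w z := undup (supp w ++ supp z).

Lemma common_suppl w z : {subset supp w <= common_supp w z}.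
Proof. by move=> e ew; rewrite mem_undup mem_cat ew. Qed.

Lemma common_suppr w z : {subset supp z <= common_supp w z}.
Proof. by move=> e ez; rewrite mem_undup mem_cat ez orbT. Qed.

Lemma common_supp_cat w z : {subset supp (catw w z) <= common_supp w z}.
Proof. by move=> e; rewrite !mem_undup mem_cat !mem_undup map_cat mem_cat. Qed.

Lemma valw_ext w z : w.1 = z.1 -> coef w =1 coef z -> valw w = valw z.
Proof.
move=> wz1 wz2.
rewrite !(@valwE (common_supp w z)) ?undup_uniq //; first last.
- exact: common_suppl.
- exact: common_suppr.
by rewrite wz1; congr (_ + _); apply: eq_bigr => e _; rewrite wz2.
Qed.

Lemma neutralw_ext w z : coef w =1 coef z -> neutralw w -> neutralw z.
Proof. by move=> wz nw e; rewrite -wz. Qed.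

Lemma neutralw_cat w z : neutralw w -> neutralw z -> neutralw (catw w z).
Proof. by move=> nw nz e; rewrite coef_cat; exact: neutralD. Qed.

Lemma neutralw_catr w z : neutralw w -> neutralw (catw w z) -> neutralw z.
Proof. by move=> nw nwz e; apply: neutralB (nw e) _; rewrite -coef_cat. Qed.

Lemma valw_cat w z : neutralw w -> neutralw z -> valw (catw w z) = valw w + valw z.
Proof.
move=> nw nz; rewrite !(@valwE (common_supp w z)) ?undup_uniq //; first last.
- exact: common_supp_cat.
- exact: common_suppl.
- exact: common_suppr.
rewrite addrACA -big_split; congr (_ + _); apply: eq_bigr => e _.
by rewrite coef_cat val_ofD.
Qed.

(* The coarsest congruence compatible with neutrality and evaluation. *)
Definition congr_word : rel word := fun w w' =>
  `[< forall z, (neutralw (catw w z) <-> neutralw (catw w' z)) /\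
        (neutralw (catw w z) -> valw (catw w z) = valw (catw w' z)) >].

Lemma congr_word_refl : reflexive congr_word.
Proof. by move=> w; apply/asboolP. Qed.

Lemma congr_word_sym : symmetric congr_word.
Proof.
suff S w w' : congr_word w w' -> congr_word w' w.
  by move=> w w'; apply/idP/idP; exact: S.
move=> /asboolP ww'; apply/asboolP => z; have [n v] := ww' z.
by split; [rewrite n | rewrite -n => /v].
Qed.

Lemma congr_word_trans : transitive congr_word.
Proof.
move=> w2 w1 w3 /asboolP w12 /asboolP w23; apply/asboolP => z.
have [[n12 v12] [n23 v23]] := (w12 z, w23 z).
by split=> [|n1]; [rewrite n12 n23 | rewrite v12 // v23 // -n12].
Qed.

Canonical congr_word_equiv :=
  EquivRel congr_word congr_word_refl congr_word_sym congr_word_trans.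

Definition extension := {eq_quot congr_word}.
HB.instance Definition _ := Choice.on extension.
HB.instance Definition _ := Quotient.on extension.

Definition pi_word w : extension := \pi_extension w.

Lemma pi_wordP w w' : reflect (pi_word w = pi_word w') (congr_word w w').
Proof. by apply: (iffP idP) => [/eqmodP|/eqmodP]. Qed.

Lemma word_ind (P : extension -> Prop) : (forall w, P (pi_word w)) -> forall b, P b.
Proof. by move=> Pw b; rewrite -[b]reprK; exact: Pw. Qed.

Lemma pi_word_ext w z : w.1 = z.1 -> coef w =1 coef z -> pi_word w = pi_word z.
Proof.
move=> wz1 wz2; apply/pi_wordP/asboolP => t.
have E : coef (catw w t) =1 coef (catw z t).
  by move=> e; rewrite !coef_cat wz2.
split; first by split; apply: neutralw_ext => // e; rewrite E.
by move=> _; apply: valw_ext => //=; rewrite wz1.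
Qed.

Lemma catwA : associative catw.
Proof. by move=> w z t; rewrite /catw /= addrA catA. Qed.

Lemma pi_catwC w z : pi_word (catw w z) = pi_word (catw z w).
Proof. by apply: pi_word_ext => [|e]; rewrite ?coef_cat /= addrC. Qed.

(** [congr_word] quantifies over all continuations, so it is a congruence: testing [catw w z]
    against [t] is testing [w] against [catw z t]. *)
Lemma pi_catwl w w' z : pi_word w = pi_word w' ->
  pi_word (catw w z) = pi_word (catw w' z).
Proof.
by move=> /pi_wordP/asboolP ww'; apply/pi_wordP/asboolP => t; rewrite -!catwA.
Qed.

Definition ext_add (b c : extension) : extension := pi_word (catw (repr b) (repr c)).
Definition ext_zero : extension := pi_word (0, [::]).

Lemma pi_wordD w z : ext_add (pi_word w) (pi_word z) = pi_word (catw w z).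
Proof.
rewrite /ext_add (@pi_catwl _ w); last exact: reprK.
by rewrite pi_catwC [RHS]pi_catwC; apply: pi_catwl; exact: reprK.
Qed.

Lemma ext_addA : associative ext_add.
Proof.
elim/word_ind => w; elim/word_ind => z; elim/word_ind => t.
by rewrite !pi_wordD catwA.
Qed.

Lemma ext_addC : commutative ext_add.
Proof. by elim/word_ind => w; elim/word_ind => z; rewrite !pi_wordD pi_catwC. Qed.

Lemma ext_add0 : left_id ext_zero ext_add.
Proof. by elim/word_ind => -[m l]; rewrite pi_wordD /catw /= add0r. Qed.

HB.instance Definition _ :=
  GRing.isNmodule.Build extension ext_addA ext_addC ext_add0.

Lemma pi_word_cat w z : pi_word (catw w z) = pi_word w + pi_word z.
Proof. by rewrite -pi_wordD. Qed.

Definition emb (a : M) : extension := pi_word (a, [::]).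

Lemma emb_additive : nmod_morphism emb.
Proof. by split=> // a b; rewrite /emb -pi_word_cat. Qed.

HB.instance Definition _ := GRing.isNmodMorphism.Build M extension emb emb_additive.

Lemma coef_nil a e : coef (a, [::]) e = 0.
Proof. exact: big_nil. Qed.

Lemma neutralw_nil a : neutralw (a, [::]).
Proof. by move=> e; rewrite coef_nil; exact: neutral0. Qed.

Lemma valw_nil a : valw (a, [::]) = a.
Proof. by rewrite /valw big_nil addr0. Qed.

(** Next to a neutral [w], a continuation gives a neutral word exactly when it is itself neutral,
    and then values add. No continuation can therefore tell [w] from its value. *)
Lemma pi_word_neutral w : neutralw w -> pi_word w = emb (valw w).
Proof.
move=> nw; apply/pi_wordP/asboolP => z; split.
  split=> nz; apply: neutralw_cat; first exact: neutralw_nil.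
  - exact: neutralw_catr nz.
  - by [].
  - by apply: neutralw_catr nz; exact: neutralw_nil.
move=> nwz; have nz := neutralw_catr nw nwz.
by rewrite !valw_cat ?valw_nil //; exact: neutralw_nil.
Qed.

(** Testing against the trivial continuation already reads off neutrality and value. With the
    previous lemma, the image of [emb] consists exactly of the classes of neutral words. *)
Lemma pi_word_eq_emb w a : pi_word w = emb a -> neutralw w /\ valw w = a.
Proof.
move=> /pi_wordP/asboolP/(_ (0, [::])).
have E t : catw t (0, [::]) = t by case: t => m l; rewrite /catw /= addr0 cats0.
rewrite !E valw_nil => -[n v].
have nw : neutralw w by apply/n; exact: neutralw_nil.
by split; last exact: v.
Qed.

Lemma emb_inj : injective emb.
Proof. by move=> a b /pi_word_eq_emb[_]; rewrite valw_nil. Qed.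

Definition gen (e : idx D) (v : wgt D) : extension := pi_word (0, [:: (e, v)]).

Lemma coef_gen a e v e' : coef (a, [:: (e, v)]) e' = if e == e' then v else 0.
Proof. by rewrite /coef big_mkcond big_seq1. Qed.

Lemma genD e (v v' : wgt D) : gen e (v + v') = gen e v + gen e v'.
Proof.
rewrite -pi_word_cat; apply: pi_word_ext => [|e'] /=; first by rewrite addr0.
by rewrite coef_cat !coef_gen; case: eqP; rewrite ?addr0.
Qed.

Lemma gen_neutral e v : neutral e v -> gen e v = emb (val_of e v).
Proof.
move=> nv; rewrite /gen pi_word_neutral.
  by rewrite /valw /= add0r big_seq1 coef_gen eqxx.
by move=> e'; rewrite coef_gen; case: eqP => [<-//|_]; exact: neutral0.
Qed.

Lemma gen0 e : gen e 0 = 0.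
Proof. by rewrite gen_neutral ?val_of0 ?raddf0 //; exact: neutral0. Qed.

Lemma genMn e v n : gen e (v *+ n) = gen e v *+ n.
Proof. by elim: n => [|n IHn]; rewrite ?gen0 // !mulrS genD IHn. Qed.

(** This is where the congruence being the coarsest one pays off. In any neutral continuation the
    index [e] contributes some [val_of e (v + v')], and by assumption this summand alone erases the
    difference between [a] and [b]. *)
Lemma gen_absorb e (v : wgt D) a b :
  (forall v', neutral e (v + v') ->
     a + val_of e (v + v') = b + val_of e (v + v')) ->
  emb a + gen e v = emb b + gen e v.
Proof.
move=> ab; rewrite -!pi_word_cat /catw /= !addr0.
apply/pi_wordP/asboolP => z; split.
  by split; apply: neutralw_ext => e'; rewrite !coef_cat !coef_gen.
move=> nz; set s := undup (e :: supp z).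
have us : uniq s by exact: undup_uniq.
have es : e \in s by rewrite mem_undup mem_head.
have sub c : {subset supp (catw (c, [:: (e, v)]) z) <= s}.
  by move=> i; rewrite !mem_undup /= !inE mem_undup.
rewrite !(valwE us (sub _)) /= addrAC [RHS]addrAC; congr (_ + _).
rewrite !(bigD1_seq e) //= !addrA !coef_cat !coef_gen eqxx ab.
  by congr (_ + _); apply: eq_bigr => i ie; rewrite !coef_cat !coef_gen.
by have := nz e; rewrite coef_cat coef_gen eqxx.
Qed.

Lemma emb_unitary : unitary emb.
Proof.
split; first exact: emb_inj.
  elim/word_ind => -[a l]; elim: l => [|[e v] l [c ac]].
    by exists a; exists 0; rewrite addr0.
  (* Bound the letters one at a time: [gen e v] lies below the neutral [gen e (v + v')], which is in
     the image. *)
  have [v' nvv'] := neutral_cofinal e v.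
  exists (val_of e (v + v') + c).
  have -> : pi_word (a, (e, v) :: l) = gen e v + pi_word (a, l).
    by rewrite -pi_word_cat /catw /= add0r.
  rewrite raddfD; apply: alg_leD => //.
  by exists (gen e v'); rewrite -genD gen_neutral.
(* Prepending [a0] adds no generator, so neutrality of the sum is neutrality of [w]. *)
move=> a0 a1; elim/word_ind => w; rewrite -pi_word_cat => /pi_word_eq_emb[naw _].
by exists (valw w); rewrite pi_word_neutral.
Qed.

(** If the sum of [w] and [z] is zero, its value is a vanishing sum in [M], so every index
    contributes 0. The assumption then makes [w] neutral, hence also [z]: both come from [M], where
    conicality applies once more. *)
Lemma extension_cone : cone M ->
  (forall e (v v' : wgt D),
     neutral e (v + v') -> val_of e (v + v') = 0 -> neutral e v) ->
  cone extension.
Proof.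
move=> coneM valD0; elim/word_ind => w; elim/word_ind => z.
rewrite -pi_word_cat => /pi_word_eq_emb[nwz vwz].
move: (vwz).
rewrite (valwE (undup_uniq _) (@common_supp_cat w z)).
move=> /coneM[_ /(cone_sum_eq0 coneM) v0].
have nw : neutralw w.
  move=> e; case: (boolP (e \in common_supp w z)) => [ewz|].
    apply: (valD0 _ _ (coef z e)); rewrite -coef_cat; [exact: nwz|exact: v0].
  rewrite mem_undup mem_cat negb_or => /andP[/coef_out-> _]; exact: neutral0.
have nz := neutralw_catr nw nwz.
move: vwz; rewrite valw_cat // => /coneM[vw vz].
by rewrite !pi_word_neutral // vw vz raddf0.
Qed.

(** The coefficients of [b *+ m] are [m] times those of [b], so the root condition applies index by
    index. *)
Lemma emb_strongly_unitary :
  (forall e (v : wgt D) m, (0 < m)%N -> neutral e (v *+ m) -> neutral e v) ->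
  strongly_unitary emb.
Proof.
move=> neutral_root; split; first exact: emb_unitary.
move=> m + m0; elim/word_ind => w [a].
pose wm k := iter k (catw w) (0, [::]).
have wmE k : pi_word w *+ k = pi_word (wm k).
  by elim: k => [|k IHk] //; rewrite mulrS IHk pi_word_cat.
have coefE k e : coef (wm k) e = coef w e *+ k.
  by elim: k => [|k IHk]; rewrite ?coef_nil //= coef_cat IHk mulrS.
rewrite wmE => /esym/pi_word_eq_emb[nwm _].
exists (valw w); rewrite pi_word_neutral // => e.
by apply: neutral_root m0 _; rewrite -coefE.
Qed.

End Extension.

(** * Adjoining refinements *)

Section Refinement.

Variable M : nmodType.

(** The encoding is [((a0, a1), (b0, b1))]. Excluding zero terms ensures that a combination of value
    0 has all multiplicities 0, as [refine_cone] requires. *)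
Definition refine_idx := {t : (M * M) * (M * M) |
  [&& t.1.1 + t.1.2 == t.2.1 + t.2.2, t.1.1 != 0, t.1.2 != 0, t.2.1 != 0
    & t.2.2 != 0]}.

(* [((n00, n01), (n10, n11))] stands for the sum of the [n_ij c_ij]. *)
Definition counts := ((nat * nat) * (nat * nat))%type.

Definition balanced (v : counts) : Prop :=
  (v.1.1 + v.2.2 = v.1.2 + v.2.1)%N.

(** The value of [p] pairs c00 + c01, [q] pairs c10 + c11, [r] pairs c00 + c10 and [s] pairs c01 +
    c11. *)
Definition pairing (e : refine_idx) (p q r s : nat) : M :=
  (\val e).1.1 *+ p + (\val e).1.2 *+ q + ((\val e).2.1 *+ r + (\val e).2.2 *+ s).

(* Pair as many [c00] as possible with [c01], which gives [a0], and the rest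
   with [c10]. *)
Definition pairing_val (e : refine_idx) (v : counts) : M :=
  let p := minn v.1.1 v.1.2 in
  pairing e p (v.2.2 - (v.1.2 - p)) (v.1.1 - p) (v.1.2 - p).

Lemma pairingD e p q r s p' q' r' s' :
  pairing e (p + p') (q + q') (r + r') (s + s') =
  pairing e p q r s + pairing e p' q' r' s'.
Proof.
by rewrite /pairing !mulrnDr [RHS]addrACA; congr (_ + _); exact: addrACA.
Qed.

(** These are two ways of pairing [d] copies of all four c_ij; they agree because a0 + a1 = b0 +
    b1. *)
Lemma pairing_shift e d : pairing e d d 0 0 = pairing e 0 0 d d.
Proof.
case: e => t te; rewrite /pairing /= !mulr0n !addr0 !add0r.
by rewrite -!mulrnDl; case/andP: te => /eqP->.
Qed.

(** Independence of the value from the pairing: an arbitrary pairing becomes the one used by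
    [pairing_val] by trading copies of b0 + b1 for copies of a0 + a1. *)
Lemma pairing_valE e p q r s :
  pairing_val e ((p + r, p + s), (q + r, q + s))%N = pairing e p q r s.
Proof.
rewrite /pairing_val /= -addn_minr.
(* [d] is the number of trades, the most that [r] and [s] allow. *)
set d := minn r s.
have [rE sE] : r = (r - d + d)%N /\ s = (s - d + d)%N.
  by rewrite !subnK ?geq_minl ?geq_minr.
have -> : (p + r - (p + d) = r - d)%N by rewrite subnDl.
have -> : (p + s - (p + d) = s - d)%N by rewrite subnDl.
have -> : (q + s - (s - d) = q + d)%N by rewrite {1}sE addnCA addnC addnK.
have -> : pairing e (p + d) (q + d) (r - d) (s - d) =
    pairing e p q (r - d) (s - d) + pairing e d d 0 0.
  by rewrite -pairingD !addn0.
by rewrite pairing_shift -pairingD !addn0 -rE -sE.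
Qed.

Lemma balancedP v : balanced v ->
  exists p q r s, v = ((p + r, p + s), (q + r, q + s))%N.
Proof.
case: v => [[n00 n01] [n10 n11]]; rewrite /balanced /= => nE.
exists (minn n00 n01), (n11 - (n01 - minn n00 n01))%N.
exists (n00 - minn n00 n01)%N, (n01 - minn n00 n01)%N.
by congr (_, _, (_, _)); lia.
Qed.

Lemma countsD (v w : counts) :
  v + w = ((v.1.1 + w.1.1, v.1.2 + w.1.2), (v.2.1 + w.2.1, v.2.2 + w.2.2))%N.
Proof. by case: v => [[? ?] [? ?]]; case: w => [[? ?] [? ?]]. Qed.

Lemma balanced0 : balanced 0.
Proof. by []. Qed.

Lemma balancedD v w : balanced v -> balanced w -> balanced (v + w).
Proof. by rewrite countsD /balanced /=; lia. Qed.

Lemma balancedB v w : balanced v -> balanced (v + w) -> balanced w.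
Proof. by rewrite countsD /balanced /=; lia. Qed.

Lemma balanced_cofinal v : exists w, balanced (v + w).
Proof.
(* Swapping c00 with c01 and c10 with c11 reverses the sign of the degree. *)
exists ((v.1.2, v.1.1), (v.2.2, v.2.1)).
by rewrite countsD /balanced /=; lia.
Qed.

Lemma balanced_root v m : (0 < m)%N -> balanced (v *+ m) -> balanced v.
Proof.
have E k : v *+ k = ((v.1.1 * k, v.1.2 * k), (v.2.1 * k, v.2.2 * k))%N.
  elim: k => [|k IHk]; first by rewrite !muln0.
  by rewrite mulrS IHk countsD /= !mulnS.
by rewrite E /balanced /= -!mulnDl => m0 /eqP; rewrite eqn_pmul2r // => /eqP.
Qed.

Lemma pairing_val0 e : pairing_val e 0 = 0.
Proof. by rewrite /pairing_val /pairing /= !mulr0n !addr0. Qed.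

(** Juxtaposing a pairing of [v] and a pairing of [w] pairs [v + w], and any pairing computes the
    value. *)
Lemma pairing_valD e v w : balanced v -> balanced w ->
  pairing_val e (v + w) = pairing_val e v + pairing_val e w.
Proof.
move=> /balancedP[p [q [r [s ->]]]] /balancedP[p' [q' [r' [s' ->]]]].
rewrite countsD /= (addnACA p r) (addnACA p s) (addnACA q r) (addnACA q s).
by rewrite !pairing_valE pairingD.
Qed.

Definition refinement_gradation : gradation M :=
  @Gradation M refine_idx counts (fun=> balanced) pairing_val
    (fun=> balanced0) (fun=> balancedD) (fun=> balancedB) (fun=> balanced_cofinal)
    pairing_val0 pairing_valD.

Definition refine : nmodType := extension refinement_gradation.

Definition refine_emb : {additive M -> refine} := emb refinement_gradation.

Lemma refine_strongly_unitary : strongly_unitary refine_emb.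
Proof. by apply: emb_strongly_unitary => e v m; exact: balanced_root. Qed.

Lemma refine_cone : cone M -> cone refine.
Proof.
move=> coneM; apply: extension_cone => //= e v w.
move=> /balancedP[p [q [r [s vw]]]]; rewrite vw pairing_valE /pairing.
move=> /coneM[/coneM[ap aq] /coneM[br bs]].
have /and5P[_ a0 a1 b0 b1] := valP e.
have [p0 q0] := (cone_mulrn_eq0 coneM a0 ap, cone_mulrn_eq0 coneM a1 aq).
have [r0 s0] := (cone_mulrn_eq0 coneM b0 br, cone_mulrn_eq0 coneM b1 bs).
(* All multiplicities vanish, so [v + w] is zero, hence so is [v]. *)
move: vw; rewrite p0 q0 r0 s0 countsD => -[*].
by rewrite /balanced; lia.
Qed.

(** Refinement across one stage: the equation lives in [M], its solution in [N]. Along a tower this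
    yields refinement in the limit. *)
Definition refinable (N : nmodType) (f : M -> N) :=
  forall a0 a1 b0 b1 : M, a0 + a1 = b0 + b1 ->
  exists c00 c01 c10 c11 : N,
    [/\ f a0 = c00 + c01, f a1 = c10 + c11, f b0 = c00 + c10 & f b1 = c01 + c11].

Lemma refine_refinable : refinable refine_emb.
Proof.
move=> a0 a1 b0 b1 ab.
have /esym fab : refine_emb a0 + refine_emb a1 = refine_emb b0 + refine_emb b1.
  by rewrite -!raddfD ab.
(* Equations with a zero term are not indices; they have an obvious refinement. *)
have [a00|a0N] := eqVneq a0 0.
  exists 0, 0, (refine_emb b0), (refine_emb b1).
  by rewrite fab a00 raddf0 !add0r.
have [a10|a1N] := eqVneq a1 0.
  exists (refine_emb b0), (refine_emb b1), 0, 0.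
  by rewrite fab a10 raddf0 !addr0.
have [b00|b0N] := eqVneq b0 0.
  exists 0, (refine_emb a0), 0, (refine_emb a1).
  by rewrite -fab b00 raddf0 !add0r.
have [b10|b1N] := eqVneq b1 0.
  exists (refine_emb a0), 0, (refine_emb a1), 0.
  by rewrite -fab b10 raddf0 !addr0.
have te : [&& a0 + a1 == b0 + b1, a0 != 0, a1 != 0, b0 != 0 & b1 != 0].
  by rewrite ab eqxx a0N a1N b0N b1N.
pose e : refine_idx := exist _ ((a0, a1), (b0, b1)) te.
pose c v : refine := gen (D := refinement_gradation) e v.
have cE p q r s : c ((p + r, p + s), (q + r, q + s))%N = refine_emb (pairing e p q r s).
  by rewrite /c gen_neutral /= ?pairing_valE // /balanced /=; lia.
have cD v w : c (v + w) = c v + c w by exact: genD.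
(* The four unit vectors are the formal c_ij themselves. *)
exists (c ((1, 0), (0, 0))%N), (c ((0, 1), (0, 0))%N).
exists (c ((0, 0), (1, 0))%N), (c ((0, 0), (0, 1))%N).
rewrite -!cD; split.
- by apply: etrans (esym (cE 1 0 0 0)%N); rewrite /pairing !mulr0n !addr0.
- by apply: etrans (esym (cE 0 1 0 0)%N); rewrite /pairing !mulr0n !addr0 add0r.
- by apply: etrans (esym (cE 0 0 1 0)%N); rewrite /pairing !mulr0n !addr0 add0r.
- by apply: etrans (esym (cE 0 0 0 1)%N); rewrite /pairing !mulr0n !add0r.
Qed.

End Refinement.

(** * Adjoining quotients by positive integers *)

Section Division.

Variable M : nmodType.

Definition division_idx := {t : nat * M | (0 < t.1)%N && (t.2 != 0)}.

(** For [e] given by [(p, a)], the weight [k] stands for [k] copies of the adjoined u with p u =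
    a. *)
Definition division_neutral (e : division_idx) (k : nat) : Prop := ((\val e).1 %| k)%N.

Definition division_val (e : division_idx) (k : nat) : M :=
  (\val e).2 *+ (k %/ (\val e).1)%N.

Lemma division_neutral0 e : division_neutral e 0.
Proof. exact: dvdn0. Qed.

Lemma division_neutralD e (k l : nat) :
  division_neutral e k -> division_neutral e l -> division_neutral e (k + l).
Proof. exact: dvdn_add. Qed.

Lemma division_neutralB e (k l : nat) :
  division_neutral e k -> division_neutral e (k + l) -> division_neutral e l.
Proof. by rewrite /division_neutral => ek; rewrite dvdn_addr. Qed.

Lemma division_cofinal e (k : nat) : exists l, division_neutral e (k + l).
Proof.
(* With p the divisor, k + k (p - 1) = k p. *)
have /andP[p0 _] := valP e; exists (k * (\val e).1.-1)%N.
suff : ((\val e).1 %| k + k * (\val e).1.-1)%N by [].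
by rewrite -mulnS prednK // dvdn_mull.
Qed.

Lemma division_val0 e : division_val e 0 = 0.
Proof. by rewrite /division_val div0n mulr0n. Qed.

Lemma division_valD e (k l : nat) : division_neutral e k -> division_neutral e l ->
  division_val e (k + l) = division_val e k + division_val e l.
Proof. by move=> ek el; rewrite /division_val divnDl // mulrnDr. Qed.

Definition division_gradation : gradation M :=
  @Gradation M division_idx nat division_neutral division_val
    division_neutral0 division_neutralD division_neutralB division_cofinal
    division_val0 division_valD.

Definition divide : nmodType := extension division_gradation.

Definition divide_emb : {additive M -> divide} := emb division_gradation.

Lemma divide_unitary : unitary divide_emb.
Proof. exact: emb_unitary. Qed.

Lemma divide_cone : cone M -> cone divide.
Proof.
move=> coneM; apply: extension_cone => //= e v w.
have /andP[_ a0] := valP e.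
move=> /dvdnP[q vw]; rewrite /division_val vw mulnK; last by case/andP: (valP e).
move=> /(cone_mulrn_eq0 coneM a0) q0; move: vw; rewrite q0 mul0n => vw.
suff -> : v = 0%N by exact: dvdn0.
by move/eqP: vw; rewrite addn_eq0 => /andP[/eqP].
Qed.

(** A single [u] serves all pairs from [M] at once. In the limit, a finite set [X] fits into one
    stage, which gives normal divisibility. *)
Definition divisible_in (N : nmodType) (f : M -> N) :=
  forall (p : nat) (a : M), (0 < p)%N ->
  exists u : N, u *+ p = f a /\
    (forall x y : M, x + a = y + a -> f x + u = f y + u).

Lemma divide_divisible : divisible_in divide_emb.
Proof.
move=> p a p0; have [->|aN] := eqVneq a 0.
  exists 0; split=> [|x y]; first by rewrite raddf0 mul0rn.
  by rewrite !addr0 => ->.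
have te : (0 < p)%N && (a != 0) by rewrite p0.
pose e : division_idx := exist _ (p, a) te.
exists (gen (D := division_gradation) e 1%N); split.
  rewrite -genMn gen_neutral /=.
    by rewrite /division_val /= natn divnn p0.
  by rewrite /division_neutral /= natn.
(* A multiple of [p] of the form 1 + k is nonzero, so its quotient is positive and its value
   contains a copy of [a]. *)
move=> x y xy; apply: gen_absorb => k /= /dvdnP[[//|q] ->].
by rewrite /division_val /= mulnK // mulrS !addrA xy.
Qed.

End Division.

(** * Direct limits *)

Lemma unitary_comp (A B C : nmodType) (f : {additive A -> B}) (g : {additive B -> C}) :
  unitary f -> unitary g -> unitary (g \o f).
Proof.
move=> [f_inj f_cof f_uni] [g_inj g_cof g_uni]; split.
- exact: inj_comp.
- move=> c; have [b cb] := g_cof c; have [a [d ba]] := f_cof b; exists a.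
  by apply: alg_le_trans cb _; exists (g d); rewrite -raddfD ba.
- move=> a0 a1 c /= ac; have [b bc] := g_uni _ _ _ ac.
  move: ac; rewrite -bc -raddfD => /g_inj /f_uni[a <-].
  by exists a.
Qed.

Section DirectLimit.

Variables (B : nat -> nmodType) (f : forall n, {additive B n -> B n.+1}).

(* Junk value [0] when [m < n]. *)
Fixpoint transfer (n m : nat) : B n -> B m :=
  match m return B n -> B m with
  | 0 => match n with 0 => id | _ => fun=> 0 end
  | m'.+1 =>
    match n =P m'.+1 with
    | ReflectT e => fun x => ecast i (B i) e x
    | ReflectF _ => fun x => f m' (transfer m' x)
    end
  end.

Lemma transfer_id n (x : B n) : transfer n x = x.
Proof. by case: n x => //= n x; case: eqP => // e; rewrite eq_axiomK. Qed.

Lemma transferS n m (x : B n) : (n <= m)%N -> transfer m.+1 x = f m (transfer m x).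
Proof. by move=> nm /=; case: eqP => // e; rewrite e ltnn in nm. Qed.

Lemma transferD n m : (n <= m)%N -> {morph @transfer n m : x y / x + y}.
Proof.
elim: m => [|m IHm] nm x y; first by case: n nm x y.
move: nm; rewrite leq_eqVlt ltnS => /predU1P[nm|nm].
  by subst n; rewrite !transfer_id.
by rewrite !transferS // IHm // raddfD.
Qed.

Lemma transfer0 n m : (n <= m)%N -> transfer m (0 : B n) = 0.
Proof.
elim: m => [|m IHm] nm; first by case: n nm.
move: nm; rewrite leq_eqVlt ltnS => /predU1P[nm|nm].
  by subst n; rewrite !transfer_id.
by rewrite !transferS // IHm // raddf0.
Qed.

Lemma transfer_trans n m k (x : B n) : (n <= m)%N -> (m <= k)%N ->
  transfer k (transfer m x) = transfer k x.
Proof.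
move=> nm mk; rewrite -(subnK mk); elim: (k - m)%N => [|d IHd].
  by rewrite transfer_id.
by rewrite !transferS ?IHd ?leq_addl // (leq_trans nm) ?leq_addl.
Qed.

Notation germ := {n : nat & B n}.

Definition thread (u : germ) k : B k := transfer k (tagged u).

(** Only large stages are compared, so the junk values of [transfer] below the tags never matter. *)
Definition eventually_eq : rel germ := fun u v =>
  `[< exists N, forall k, (N <= k)%N -> thread u k = thread v k >].

Lemma eventually_eq_refl : reflexive eventually_eq.
Proof. by move=> u; apply/asboolP; exists 0%N. Qed.

Lemma eventually_eq_sym : symmetric eventually_eq.
Proof.
suff S u v : eventually_eq u v -> eventually_eq v u.
  by move=> u v; apply/idP/idP; exact: S.
by move=> /asboolP[N uv]; apply/asboolP; exists N => k /uv.
Qed.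

Lemma eventually_eq_trans : transitive eventually_eq.
Proof.
move=> v u w /asboolP[N uv] /asboolP[N' vw]; apply/asboolP; exists (maxn N N') => k.
by rewrite geq_max => /andP[Nk N'k]; rewrite uv ?vw.
Qed.

Canonical eventually_eq_equiv := EquivRel eventually_eq
  eventually_eq_refl eventually_eq_sym eventually_eq_trans.

Definition dirlim := {eq_quot eventually_eq}.
HB.instance Definition _ := Choice.on dirlim.
HB.instance Definition _ := Quotient.on dirlim.

Definition lim_class (u : germ) : dirlim := \pi_dirlim u.

Lemma lim_classP u v : lim_class u = lim_class v <->
  exists N, forall k, (N <= k)%N -> thread u k = thread v k.
Proof. by split=> [/eqmodP/asboolP|/asboolP uv]; last exact/eqmodP. Qed.

Lemma germ_ind (P : dirlim -> Prop) : (forall u, P (lim_class u)) -> forall b, P b.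
Proof. by move=> Pu b; rewrite -[b]reprK; exact: Pu. Qed.

Definition germ_add (u v : germ) : germ :=
  let n := maxn (tag u) (tag v) in existT _ n (thread u n + thread v n).

Lemma thread_add u v k : (maxn (tag u) (tag v) <= k)%N ->
  thread (germ_add u v) k = thread u k + thread v k.
Proof.
move=> uvk; rewrite {1}/thread /= transferD // /thread !transfer_trans //.
- exact: leq_maxr.
- exact: leq_maxl.
Qed.

Definition lim_add (b c : dirlim) : dirlim := lim_class (germ_add (repr b) (repr c)).
Definition lim_zero : dirlim := lim_class (existT _ 0%N (0 : B 0%N)).

Lemma lim_class_add u v : lim_add (lim_class u) (lim_class v) = lim_class (germ_add u v).
Proof.
have [N uN] : exists N, forall k, (N <= k)%N -> thread (repr (lim_class u)) k = thread u k.
  by apply/lim_classP; exact: reprK.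
have [N' vN] : exists N, forall k, (N <= k)%N -> thread (repr (lim_class v)) k = thread v k.
  by apply/lim_classP; exact: reprK.
apply/lim_classP.
set n := maxn (tag (repr (lim_class u))) (tag (repr (lim_class v))).
exists (maxn (maxn N N') (maxn n (maxn (tag u) (tag v)))) => k.
rewrite geq_max => /andP[+ +]; rewrite geq_max => /andP[Nk N'k].
rewrite geq_max => /andP[nk uvk].
by rewrite !thread_add // uN // vN.
Qed.

Lemma lim_addA : associative lim_add.
Proof.
elim/germ_ind => u; elim/germ_ind => v; elim/germ_ind => w.
rewrite !lim_class_add; apply/lim_classP.
exists (maxn (tag u) (maxn (tag v) (tag w))) => k.
rewrite !geq_max => /and3P[uk vk wk].
by rewrite !thread_add ?addrA //= !geq_max ?uk ?vk ?wk.
Qed.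

Lemma lim_addC : commutative lim_add.
Proof.
elim/germ_ind => u; elim/germ_ind => v; rewrite !lim_class_add; apply/lim_classP.
by exists (maxn (tag u) (tag v)) => k uvk; rewrite !thread_add 1?addrC // maxnC.
Qed.

Lemma lim_add0 : left_id lim_zero lim_add.
Proof.
elim/germ_ind => u; rewrite lim_class_add; apply/lim_classP.
exists (tag u) => k uk; rewrite thread_add ?max0n //.
by rewrite {1}/thread /= transfer0 ?add0r.
Qed.

HB.instance Definition _ := GRing.isNmodule.Build dirlim lim_addA lim_addC lim_add0.

Definition lim_inj n (x : B n) : dirlim := lim_class (existT _ n x).

Lemma lim_inj_additive n : nmod_morphism (@lim_inj n).
Proof.
split=> [|x y]; first by apply/lim_classP; exists n => k nk; rewrite /thread /= !transfer0.
rewrite [RHS]lim_class_add; apply/lim_classP; exists n => k nk.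
by rewrite thread_add /= ?maxnn // /thread /= transferD.
Qed.

HB.instance Definition _ n :=
  GRing.isNmodMorphism.Build (B n) dirlim (@lim_inj n) (lim_inj_additive n).

Lemma lim_injS n (x : B n) : lim_inj (f n x) = lim_inj x.
Proof.
apply/lim_classP; exists n.+1 => k nk; rewrite /thread /=.
by rewrite -[f n x]/(f n x) -{1}(transfer_id x) -transferS // transfer_trans.
Qed.

Lemma lim_inj_surj (b : dirlim) : exists n (x : B n), b = lim_inj x.
Proof. by elim/germ_ind: b => -[n x]; exists n, x. Qed.

Lemma lim_inj_up n m (x : B n) : (n <= m)%N -> exists y : B m, lim_inj x = lim_inj y.
Proof.
move=> nm; rewrite -(subnK nm); elim: (m - n)%N => [|d [y ->]]; first by exists x.
by exists (f _ y); rewrite lim_injS.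
Qed.

(** Reduces statements about finitely many elements of the limit to a single stage. *)
Lemma lim_inj_common (s : seq dirlim) : exists n (t : seq (B n)), s = map (@lim_inj n) t.
Proof.
elim: s => [|b s [n [t ->]]]; first by exists 0%N, [::].
have [m [x ->]] := lim_inj_surj b.
have [y ->] := lim_inj_up x (leq_maxl m n).
exists (maxn m n); elim: t => [|z t [[//|y' t'] [yE tE]]]; first by exists [:: y].
have [z' zE] := lim_inj_up z (leq_maxr m n).
by exists [:: y', z' & t']; rewrite /= -yE -zE tE.
Qed.

Hypothesis f_unitary : forall n, unitary (f n).

Lemma lim_inj_inj n : injective (@lim_inj n).
Proof.
have f_inj m : injective (f m) by case: (f_unitary m).
move=> x y /lim_classP[N /(_ (N + n)%N (leq_addr _ _))]; rewrite /thread /=.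
elim: N => [|N IHN]; first by rewrite !transfer_id.
by rewrite !transferS ?leq_addl // => /f_inj.
Qed.

(** Descent on the stage of [b]: at stage [n.+1] it is bounded by an element of stage [n], as [f n]
    is cofinal. If [b] solves an equation over stage 0, injectivity moves that equation to stage
    [n.+1], and unitarity of [f n] brings [b] down to stage [n]. *)
Lemma lim_inj_unitary : unitary (@lim_inj 0).
Proof.
split; first exact: lim_inj_inj.
  move=> b; have [n [x ->]] := lim_inj_surj b.
  elim: n x => [|n IHn] x; first by exists x, 0; rewrite addr0.
  have [_ /(_ x)[y [z xzy]] _] := f_unitary n.
  have [a ya] := IHn y; exists a; apply: alg_le_trans ya.
  by exists (lim_inj z); rewrite -(lim_injS y) -xzy raddfD.
move=> a0 a1 b; have [n [x ->]] := lim_inj_surj b.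
elim: n x => [|n IHn] x; first by exists x.
have [a0' a0E] := lim_inj_up a0 (leq0n n).
have [a1' a1E] := lim_inj_up a1 (leq0n n).
move=> ax; move: (ax); rewrite /= a0E a1E -!(lim_injS a0') -!(lim_injS a1') -raddfD.
have [_ _ f_uni] := f_unitary n.
by move=> /lim_inj_inj /f_uni[x' xE]; move: ax; rewrite -xE lim_injS => /IHn.
Qed.

Lemma lim_inj_strongly_unitary :
  (forall n, strongly_unitary (f n)) -> strongly_unitary (@lim_inj 0).
Proof.
move=> f_strong; split; first exact: lim_inj_unitary.
move=> m b m0; have [n [x ->]] := lim_inj_surj b.
elim: n x => [|n IHn] x; first by exists x.
move=> [a aE]; have [a' a'E] := lim_inj_up a (leq0n n).
have [_ f_root] := f_strong n.
(* By injectivity [x *+ m] is already the image of an element of stage [n], so [x] descends too. *)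
move: (aE); rewrite /= a'E -(lim_injS a') -raddfMn => /lim_inj_inj a'x.
have [x' xE] : in_image (f n) x by apply: (f_root m) => //; exists a'.
by rewrite -xE lim_injS; apply: IHn; exists a; rewrite [LHS]aE -xE lim_injS.
Qed.

Lemma dirlim_cone : (forall n, cone (B n)) -> cone dirlim.
Proof.
move=> coneB b c; have [n [[|x [|y []]] //= [-> ->]]] := lim_inj_common [:: b; c].
by rewrite -raddfD -(raddf0 (@lim_inj n)) => /lim_inj_inj/coneB[-> ->].
Qed.

(** By injectivity the equation already holds at a stage containing its four terms; the next stage
    refines it. *)
Lemma dirlim_refinement : (forall n, refinable (f n)) -> refinement dirlim.
Proof.
move=> f_ref a0 a1 b0 b1.
have [n [[|x0 [|x1 [|y0 [|y1 []]]]] //= [-> -> -> ->]]] :=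
  lim_inj_common [:: a0; a1; b0; b1].
rewrite -!raddfD => /lim_inj_inj /f_ref[c00 [c01 [c10 [c11 []]]]].
rewrite -!(lim_injS x0) -!(lim_injS x1) -!(lim_injS y0) -!(lim_injS y1).
move=> -> -> -> ->; rewrite !raddfD.
by exists (lim_inj c00), (lim_inj c01), (lim_inj c10), (lim_inj c11).
Qed.

Lemma dirlim_normally_divisible :
  (forall n, divisible_in (f n)) -> normally_divisible dirlim.
Proof.
move=> f_div p X a p0; have [n [[|c t] //= [aE XE]]] := lim_inj_common (a :: X).
have [u [up uX]] := f_div n p c p0; exists (lim_inj u); split.
  by rewrite aE -(lim_injS c) -up raddfMn.
rewrite XE aE => x y /mapP[x' _ ->] /mapP[y' _ ->].
rewrite -!raddfD => /lim_inj_inj/uX xy.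
by rewrite -(lim_injS x') -(lim_injS y') -!raddfD xy.
Qed.

End DirectLimit.

(** * Iterating an extension omega times *)

Section Iteration.

Variables (step : nmodType -> nmodType) (f : forall M : nmodType, {additive M -> step M}).
Hypothesis step_cone : forall M, cone M -> cone (step M).
Hypothesis step_refinable : forall M, refinable (f M).

Definition tower A n : nmodType := iter n step A.

Definition tower_map A n : {additive tower A n -> tower A n.+1} := f (tower A n).

Definition tower_emb A : {additive tower A 0 -> dirlim (tower_map A)} :=
  @lim_inj _ (tower_map A) 0.

Lemma tower_refinement_cone A : (forall M, unitary (f M)) -> cone A ->
  refinement_cone (dirlim (tower_map A)).
Proof.
move=> f_unitary coneA.
have map_unitary n : unitary (tower_map A n) by exact: f_unitary.
split; first by apply: dirlim_cone => //; elim=> //= n; exact: step_cone.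
by apply: dirlim_refinement => // n; exact: step_refinable.
Qed.

End Iteration.

Theorem corollary1p10 (C : nmodType -> Prop)
  (hC : C = cancellative_cone \/ C = separative_cone) :
  (forall A : nmodType, C A ->
     exists (B : nmodType) (f : {additive A -> B}),
       refinement_cone B /\ normally_divisible B /\ unitary f) /\
  (forall A : nmodType, C A ->
     exists (B : nmodType) (f : {additive A -> B}),
       refinement_cone B /\ strongly_unitary f).
Proof.
have coneC A : C A -> cone A by case: hC => -> [].
split=> A /coneC coneA.
(* Each step adjoins refinements and then quotients, so both properties hold in one limit. *)
- pose f (M : nmodType) : {additive M -> divide (refine M)} := divide_emb _ \o refine_emb M.
  have f_unitary M : unitary (f M).
    apply: unitary_comp; last exact: divide_unitary.
    by case: (refine_strongly_unitary M).
  have f_ref M : refinable (f M).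
    move=> a0 a1 b0 b1 /refine_refinable[c00 [c01 [c10 [c11 [a0E a1E b0E b1E]]]]].
    exists (divide_emb _ c00), (divide_emb _ c01), (divide_emb _ c10), (divide_emb _ c11).
    by rewrite /= a0E a1E b0E b1E !raddfD.
  have f_div M : divisible_in (f M).
    move=> p a p0; have [u [up uX]] := divide_divisible (refine_emb M a) p0.
    by exists u; split=> // x y xy; apply: uX; rewrite -!raddfD xy.
  exists (dirlim (tower_map f A)), (tower_emb f A); split.
    by apply: tower_refinement_cone => // M coneM; apply/divide_cone/refine_cone.
  split; last by apply: lim_inj_unitary => n; exact: f_unitary.
  by apply: dirlim_normally_divisible => n; [exact: f_unitary|exact: f_div].
(* Here only refinements are adjoined: adjoining u with p u = a would break strong unitarity
   whenever [a] has no such root yet. *)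
- have f_unitary M : unitary (refine_emb M) by case: (refine_strongly_unitary M).
  exists (dirlim (tower_map refine_emb A)), (tower_emb refine_emb A).
  split.
    by apply: tower_refinement_cone => //; [exact: refine_cone|exact: refine_refinable].
  apply: lim_inj_strongly_unitary => n; first exact: f_unitary.
  exact: refine_strongly_unitary.
Qed.
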